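(* Let $\mathcal{T}$ be the set of all trees, rooted or unrooted, and let $T_1,T_2\in\mathcal{T}$. Then $T_1$ and $T_2$ are isomorphic if and only if $P(T_1)=P(T_2)$ in $\mathbb{Z}[x,y]$.
   Context: All trees are finite and unlabeled. A rooted tree is a tree with one distinguished vertex (the root); isomorphisms of rooted trees preserve the root. An unrooted tree has no distinguished vertex, and isomorphism of unrooted trees is graph isomorphism. $\mathcal{T}$ is the disjoint union of the set of rooted trees and the set of unrooted trees; a rooted tree is never considered isomorphic to an unrooted tree, even if they only differ by the identification of a root. $\bullet$ denotes the one-vertex rooted tree. For $k\ge 1$ and rooted trees $T_1,\dots,T_k$, $\wedge_k(T_1,\dots,T_k)$ denotes the rooted tree with a new root whose $k$ children are the roots of $T_1,\dots,T_k$. Every rooted tree other than $\bullet$ is of this form, uniquely up to reordering and isomorphism of the $T_i$. For a rooted tree, $P$ is defined recursively by $P(\bullet)=x$ and $P(\wedge_k(T_1,\dots,T_k))=y+\prod_{i=1}^k P(T_i)$ for $k\ge 1$. A leaf vertex of an unrooted tree $T$ is a vertex of degree one, and a leaf edge is an edge incident to a leaf vertex. For each leaf vertex $v$ of $T$ one obtains a rooted tree by contracting the leaf edge at $v$ and taking the resulting contracted vertex as the root (equivalently: delete $v$ and root the remaining tree at the neighbour of $v$). $\mathcal{R}_T$ is the family of rooted trees so obtained, indexed by the leaf vertices of $T$ (so it has as many members as $T$ has leaf vertices, possibly with isomorphic members counted separately; for the tree with exactly one edge it consists of two copies of $\bullet$, and for the one-vertex unrooted tree it is empty). For an unrooted tree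 $T$, $P(T)=\prod_{T_i\in\mathcal{R}_T}P(T_i)$, with the empty product equal to $1$. *)

(* Defs.v *)
From HB Require Import structures.
From mathcomp Require Import all_boot all_order all_algebra.
From mathcomp.multinomials Require Import mpoly.

Set Implicit Arguments.
Unset Strict Implicit.
Unset Printing Implicit Defensive.

Import GRing.Theory.
Local Open Scope ring_scope.

(* A graph cycle is a simple closed walk through at least three vertices;
   [ucycle e [:: u; v]] also holds for a single edge uv, whence the bound 2. *)
Record is_tree (V : finType) (e : rel V) : Prop := IsTree {
  tree_sym : forall u v : V, e u v = e v u;
  tree_irr : irreflexive e;
  tree_nonempty : (0 < #|V|)%N;
  tree_connected : forall u v : V, connect e u v;
  tree_acyclic : forall c : seq V, ucycle e c -> (size c <= 2)%N
}.

Record unrooted_tree := UnrootedTree {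
  uvert :> finType;
  uedge : rel uvert;
  uvertP : is_tree uedge
}.

Record rooted_tree := RootedTree {
  rvert :> finType;
  redge : rel rvert;
  rroot : rvert;
  rvertP : is_tree redge
}.

Arguments uedge {_}.
Arguments redge {_}.

Inductive tree :=
  | Rooted of rooted_tree
  | Unrooted of unrooted_tree.

Definition unrooted_iso (T1 T2 : unrooted_tree) : Prop :=
  exists f : T1 -> T2, bijective f /\ {mono f : u v / uedge u v}.

Definition rooted_iso (T1 T2 : rooted_tree) : Prop :=
  exists f : T1 -> T2,
    [/\ bijective f, {mono f : u v / redge u v} & f (rroot T1) = rroot T2].

Definition tree_iso (T1 T2 : tree) : Prop :=
  match T1, T2 with
  | Rooted R1, Rooted R2 => rooted_iso R1 R2
  | Unrooted U1, Unrooted U2 => unrooted_iso U1 U2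
  | _, _ => False
  end.

Definition induced (V : finType) (e : rel V) (A : pred V) :
  rel {u : V | A u} := relpre val e.

Lemma induced_connect (V : finType) (e : rel V) (A : pred V)
    (u : {u : V | A u}) (p : seq V) (w : {u : V | A u}) :
  path e (val u) p -> all A p -> last (val u) p = val w ->
  connect (@induced V e A) u w.
Proof.
elim: p u => [|x p IHp] u /=; first by move=> _ _ /val_inj ->; exact: connect0.
move=> /andP[eux px] /andP[Ax Ap] lw.
apply: (@connect_trans _ _ (Sub x Ax)); first by apply: connect1.
by apply: IHp; rewrite ?SubK.
Qed.

Lemma induced_is_tree (V : finType) (e : rel V) (A : pred V) (a : V) :
  is_tree e -> A a ->
  (forall u v : {u : V | A u}, connect (@induced V e A) u v) ->
  is_tree (@induced V e A).
Proof.
move=> [es ei _ _ ea] Aa conn; split=> //.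
- by move=> u v; exact: es.
- by move=> u; exact: ei.
- by apply/card_gt0P; exists (Sub a Aa).
- move=> c /andP[cc uc]; rewrite -(size_map val); apply: ea.
  by rewrite /ucycle cycle_map cc (map_inj_uniq val_inj).
Qed.

Section Branch.
Variables (T : rooted_tree) (c : T).

Definition redge_off_root : rel T :=
  [rel u v : T | [&& redge u v, u != rroot T & v != rroot T]].

Definition in_branch : pred T := connect redge_off_root c.

Lemma branch_is_tree : is_tree (@induced T redge in_branch).
Proof.
have os u v : redge_off_root u v = redge_off_root v u.
  rewrite /redge_off_root /= (tree_sym (rvertP T)).
  by case: (redge v u) => //=; rewrite andbC.
apply: (@induced_is_tree _ _ _ c (rvertP T)); first exact: connect0.
move=> u v.
have /connectP[p pp lp] : connect redge_off_root (val u) (val v).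
  apply: (@connect_trans _ _ c); last exact: (valP v).
  by rewrite (sym_connect_sym os); exact: (valP u).
apply: (@induced_connect _ _ _ u p v) => //.
  by apply: sub_path pp => x y /and3P[].
apply/allP => x xp; apply: connect_trans (valP u) _.
by apply: (path_connect pp); rewrite inE xp orbT.
Qed.

(* The component of c in T minus its root, rooted at c. When c is a child of
   the root of T, this is the subtree of T hanging from c. *)
Definition branch : rooted_tree :=
  RootedTree (Sub c (connect0 _ c) : {u : T | in_branch u}) branch_is_tree.

End Branch.

Section LeafContraction.
Variable T : unrooted_tree.

Definition degree (v : T) : nat := #|[set u : T | uedge v u]|.

Definition leaf_vertex : finType := {v : T | degree v == 1%N}.

Variable v : leaf_vertex.

Lemma leaf_neighbour : exists u : {u : T | u != val v}, uedge (val v) (val u).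
Proof.
have /cards1P[u uE] := valP v.
have vu : uedge (val v) u by have := set11 u; rewrite -uE inE.
have uv : u != val v.
  by apply/eqP => uv; move: vu; rewrite uv (tree_irr (uvertP T)).
by exists (Sub u uv); rewrite SubK.
Qed.

Lemma leaf_deletion_is_tree : is_tree (@induced T uedge (fun u => u != val v)).
Proof.
have [u0 _] := leaf_neighbour.
apply: (@induced_is_tree _ _ _ (val u0) (uvertP T)); first exact: (valP u0).
move=> u w.
have /connectP[q pq lq] := tree_connected (uvertP T) (val u) (val w).
move: lq; case: (shortenP pq) => p pp up _ lp.
apply: (@induced_connect _ _ _ u p w) => //.
apply/allP => z zp; apply/eqP => zv; move: zp; rewrite {z}zv => vp.
case/splitPr: vp pp up lp => p1 [|z p2].
  by rewrite last_cat /= => _ _ vw; case/eqP: (valP w).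
rewrite cat_path => /andP[_ /and3P[e1 e2 _]] up _.
have /cards1P[t tE] := valP v.
have /set1P l1 : last (val u) p1 \in [set t].
  by rewrite -tE inE (tree_sym (uvertP T)).
have /set1P z1 : z \in [set t] by rewrite -tE inE.
move: up; rewrite -cat_cons cat_uniq => /and3P[_ /hasPn/(_ z)].
rewrite !inE eqxx orbT => /(_ isT) /negP[].
by have := mem_last (val u) p1; rewrite l1 -z1 inE.
Qed.

(* Contracting the leaf edge at v and rooting at the contracted vertex: delete
   v and root what is left at the unique neighbour of v. *)
Definition leaf_contraction : rooted_tree :=
  RootedTree (xchoose leaf_neighbour) leaf_deletion_is_tree.

End LeafContraction.

Definition Zxy := {mpoly int[2]}.
Definition var_x : Zxy := 'X_ord0.
Definition var_y : Zxy := 'X_ord_max.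

(* A tree other than the one-vertex one is the wedge of the branches at the
   children of its root. The fuel n only ensures termination; any n >= #|T|
   gives the same value, see [rooted_poly_rec_fuel]. *)
Fixpoint rooted_poly_rec (n : nat) (T : rooted_tree) : Zxy :=
  if n is n'.+1 then
    if #|T| == 1%N then var_x
    else
      var_y
      + \prod_(c : T | redge (rroot T) c) rooted_poly_rec n' (branch c)
  else 0.

Definition rooted_poly (T : rooted_tree) : Zxy := rooted_poly_rec #|T| T.

Definition unrooted_poly (T : unrooted_tree) : Zxy :=
  \prod_(v : leaf_vertex T) rooted_poly (leaf_contraction v).

Definition tree_poly (T : tree) : Zxy :=
  match T with
  | Rooted R => rooted_poly R
  | Unrooted U => unrooted_poly U
  end.

(* The remaining lemmas check that [rooted_poly] is the polynomial given by the
   recursion over wedges of rooted trees. *)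

Lemma redge_root_neq (T : rooted_tree) (c : T) :
  redge (rroot T) c -> c != rroot T.
Proof. by apply: contraTneq => ->; rewrite (tree_irr (rvertP T)). Qed.

Lemma root_notin_branch (T : rooted_tree) (c : T) :
  c != rroot T -> ~~ in_branch c (rroot T).
Proof.
move=> cr; apply/negP => /connectP[p].
elim: p c cr => [|z p IHp] c cr /=; first by move=> _ rc; rewrite rc eqxx in cr.
by move=> /andP[/and3P[_ _ zr] pz]; exact: IHp.
Qed.

Lemma card_branch (T : rooted_tree) (c : T) :
  redge (rroot T) c -> (#|branch c| < #|T|)%N.
Proof.
move=> /redge_root_neq/root_notin_branch rc.
rewrite card_sig -cardsT -cardsE; apply: proper_card.
apply/properP; split; first by apply/subsetP => z _; rewrite inE.
by exists (rroot T); rewrite !inE.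
Qed.

Lemma rooted_poly_rec_fuel (n m : nat) (T : rooted_tree) :
  (#|T| <= n)%N -> (#|T| <= m)%N -> rooted_poly_rec n T = rooted_poly_rec m T.
Proof.
elim: n m T => [|n IHn] [|m] T //=.
- by move=> T0; have := tree_nonempty (rvertP T); rewrite ltnNge T0.
- by move=> _ T0; have := tree_nonempty (rvertP T); rewrite ltnNge T0.
- move=> Tn Tm; case: eqP => // _; congr (_ + _).
  apply: eq_bigr => c /card_branch bc.
  by apply: IHn; rewrite -ltnS (leq_trans bc).
Qed.

Lemma rooted_polyE (T : rooted_tree) :
  rooted_poly T =
    if #|T| == 1%N then var_x
    else var_y + \prod_(c : T | redge (rroot T) c) rooted_poly (branch c).
Proof.
have T0 := tree_nonempty (rvertP T).
rewrite {1}/rooted_poly -[#|T| in LHS](prednK T0) /=.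
case: eqP => // _; congr (_ + _); apply: eq_bigr => c /card_branch bc.
by apply: rooted_poly_rec_fuel; rewrite // -ltnS prednK.
Qed.

Lemma rooted_poly_iso (T1 T2 : rooted_tree) :
  rooted_iso T1 T2 -> rooted_poly T1 = rooted_poly T2.
Proof.
have [n] := ubnP #|T1|; elim: n T1 T2 => // n IHn T1 T2 T1n [f [bf ef rf]]; have inj_f := bij_inj bf.
rewrite !rooted_polyE (bij_eq_card bf); case: eqP => // _; congr (_ + _).
have eo : {mono f : u v / redge_off_root u v}.
  by move=> u v; rewrite /redge_off_root /= ef -rf !(inj_eq inj_f).
have ib c : {mono f : u / @in_branch T1 c u >-> @in_branch T2 (f c) u}.
  have [g fK gK] := bf.
  move=> u; apply/connectP/connectP => [[p pp lp]|[p pp ->]].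
    have pE : p = map f (map g p) by rewrite -map_comp (eq_map gK) map_id.
    move: pp lp; rewrite pE path_map last_map (eq_path eo) => pp /inj_f lp.
    by exists (map g p).
  exists (map f p); last by rewrite last_map.
  by rewrite path_map (eq_path eo).
rewrite (reindex f) /=; last exact: onW_bij.
apply: eq_big => [c|c rc]; first by rewrite -rf ef.
apply: IHn; first by rewrite -ltnS; apply: leq_trans T1n; rewrite ltnS card_branch.
have fb (u : branch c) : in_branch (f c) (f (val u)) by rewrite ib (valP u).
exists (fun u => Sub (f (val u)) (fb u)); split.
- have [g fK gK] := bf.
  have gb (w : branch (f c)) : in_branch c (g (val w)).
    by rewrite -ib gK (valP w).
  exists (fun w => Sub (g (val w)) (gb w)) => u; apply: val_inj => /=.
    by rewrite fK.
  by rewrite gK.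
- by move=> u w; rewrite /redge /= /induced /= ef.
- exact: val_inj.
Qed.

Lemma rooted_poly_bullet (T : rooted_tree) :
  #|T| = 1%N -> rooted_poly T = var_x.
Proof. by move=> T1; rewrite rooted_polyE T1. Qed.

Section Wedge.
Variables (k : nat) (Ts : 'I_k -> rooted_tree).

(* None is the new root; [wedge_in i a] is the vertex a of the i-th tree. *)
Definition wedge_vert : finType := option {i : 'I_k & rvert (Ts i)}.

Definition wedge_root : wedge_vert := None.

Definition wedge_in (i : 'I_k) (a : Ts i) : wedge_vert :=
  Some (Tagged (fun j => rvert (Ts j)) a).

Definition wedge_edge : rel wedge_vert := fun u v =>
  match u, v with
  | None, None => false
  | None, Some b => tagged b == rroot (Ts (tag b))
  | Some a, None => tagged a == rroot (Ts (tag a))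
  | Some a, Some b => (tag a == tag b) && redge (tagged a) (tagged_as a b)
  end.

Lemma wedge_in_inj (i : 'I_k) : injective (@wedge_in i).
Proof.
move=> a b [/eqP]; rewrite -tag_eqE /tag_eq /= eqxx tagged_asE.
by move=> /eqP.
Qed.

Lemma wedge_edge_in (i : 'I_k) (a b : Ts i) :
  wedge_edge (wedge_in a) (wedge_in b) = redge a b.
Proof. by rewrite /wedge_edge /= eqxx tagged_asE. Qed.

Lemma wedge_edge_inP (i : 'I_k) (a : Ts i) (u : wedge_vert) :
  wedge_edge (wedge_in a) u -> u != wedge_root -> exists b, u = @wedge_in i b.
Proof.
case: u => [[j b]|] // /andP[/= /eqP ij _] _.
by case: j / ij b => b; exists b.
Qed.

Lemma wedge_path_in (i : 'I_k) (a : Ts i) (p : seq wedge_vert) :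
  path wedge_edge (wedge_in a) p -> wedge_root \notin p ->
  exists q, p = map (@wedge_in i) q.
Proof.
elim: p a => [|u p IHp] a; first by exists [::].
rewrite inE negb_or (eq_sym wedge_root).
move=> /andP[/wedge_edge_inP eu pp] /andP[u0 p0].
have [b ub] := eu u0; rewrite ub in pp.
by have [q ->] := IHp _ pp p0; exists (b :: q); rewrite ub.
Qed.

Lemma wedge_edge_sym u v : wedge_edge u v = wedge_edge v u.
Proof.
case: u v => [[i a]|] [[j b]|] //=; rewrite (eq_sym j i).
case: eqP => //= ij; case: j / ij b => b.
by rewrite !tagged_asE (tree_sym (rvertP (Ts i))).
Qed.

Lemma wedge_root_edge (i : 'I_k) (a : Ts i) :
  wedge_edge wedge_root (wedge_in a) = (a == rroot (Ts i)).
Proof. by []. Qed.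

Lemma wedge_is_tree : is_tree wedge_edge.
Proof.
have fromroot u : connect wedge_edge wedge_root u.
  case: u => [[i a]|]; last exact: connect0.
  apply: (@connect_trans _ _ (wedge_in (rroot (Ts i)))).
    by apply: connect1; rewrite wedge_root_edge.
  have /connectP[p pp ->] := tree_connected (rvertP (Ts i)) (rroot (Ts i)) a.
  apply/connectP; exists (map (@wedge_in i) p); last by rewrite last_map.
  by rewrite path_map (eq_path (@wedge_edge_in i)).
split.
- exact: wedge_edge_sym.
- by case=> [[i a]|] //; rewrite wedge_edge_in (tree_irr (rvertP (Ts i))).
- by apply/card_gt0P; exists wedge_root.
- move=> u v; apply: connect_trans (fromroot v).
  by rewrite (sym_connect_sym wedge_edge_sym).
move=> c uc; have [c0|c0] := boolP (wedge_root \in c).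
  have [n s cs] := rot_to c0.
  rewrite -(size_rot n); move: uc; rewrite -(rot_ucycle n) cs.
  move=> /andP[]; case: s {cs} => [|[[i a]|] s] //; rewrite cons_uniq.
  rewrite /cycle rcons_path => /andP[/andP[aroot ps] ls].
  rewrite inE => /andP[/norP[_ n0] us].
  have [q sq] := wedge_path_in (a := a) ps n0.
  move: us ls; rewrite sq -(map_cons (@wedge_in i)).
  rewrite (map_inj_uniq (@wedge_in_inj i)) [last _ _]last_map.
  rewrite wedge_edge_sym wedge_root_edge.
  case: q {sq} => [|b q] //= /andP[+ _] /eqP lr.
  by rewrite (eqP aroot : a = rroot (Ts i)) -lr mem_last.
case: c uc c0 => [|[[i a]|] s] // /andP[cs us].
rewrite inE /= => n0.
have ps : path wedge_edge (wedge_in a) s.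
  by move: cs; rewrite /cycle rcons_path => /andP[].
have [q sq] := wedge_path_in ps n0.
have := tree_acyclic (rvertP (Ts i)) (_ : ucycle redge (a :: q)).
rewrite sq /= size_map; apply.
move: cs us; rewrite sq -map_cons cycle_map (map_inj_uniq (@wedge_in_inj i)).
by rewrite (eq_cycle (@wedge_edge_in i)) /ucycle => -> ->.
Qed.

Definition wedge : rooted_tree := RootedTree wedge_root wedge_is_tree.

Lemma wedge_branch_iso (i : 'I_k) :
  rooted_iso (Ts i) (@branch wedge (wedge_in (rroot (Ts i)))).
Proof.
have br (a : Ts i) :
    in_branch (T := wedge) (wedge_in (rroot (Ts i))) (wedge_in a).
  have /connectP[p pp ->] := tree_connected (rvertP (Ts i)) (rroot (Ts i)) a.
  apply/connectP; exists (map (@wedge_in i) p); last by rewrite last_map.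
  rewrite path_map (eq_path (e' := redge)) // => b c.
  by rewrite -(@wedge_edge_in i b c); exact: andbT.
have rb (u : wedge) : in_branch (T := wedge) (wedge_in (rroot (Ts i))) u ->
    exists a, u = @wedge_in i a.
  move=> /connectP[p]; elim: p (rroot (Ts i)) => [|v p IHp] a /=.
    by move=> _ ->; exists a.
  move=> /andP[/and3P[av _ v0] pp].
  by have [b vb] := wedge_edge_inP av v0; move: pp; rewrite vb; exact: IHp.
pose r := Tagged (fun j => rvert (Ts j)) (rroot (Ts i)).
exists (fun a => Sub (wedge_in a) (br a)); split.
- exists (fun w => if val w is Some b then tagged_as r b else rroot (Ts i)).
    by move=> a; rewrite SubK /= tagged_asE.
  move=> w; apply: val_inj; rewrite SubK.
  by have [a ->] := rb _ (valP w); rewrite /= tagged_asE.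
- by move=> a b; exact: wedge_edge_in.
- exact: val_inj.
Qed.

Lemma rooted_poly_wedge :
  (0 < k)%N -> rooted_poly wedge = var_y + \prod_(i < k) rooted_poly (Ts i).
Proof.
move=> k0; pose i0 := Ordinal k0.
rewrite rooted_polyE ifF; last first.
  apply/negP => /eqP/fintype1[z zE].
  by have := zE (wedge_in (rroot (Ts i0))); rewrite -(zE wedge_root).
congr (_ + _).
pose h (i : 'I_k) : wedge := wedge_in (rroot (Ts i)).
rewrite (reindex_onto h (fun u => if u is Some b then tag b else i0)) /=.
  apply: eq_big => [i|i _]; first by rewrite !eqxx.
  by rewrite (rooted_poly_iso (wedge_branch_iso i)).
by case=> [[i a]|] //= /eqP ->.
Qed.

End Wedge.

(* Main.v *)
From mathcomp Require Import all_boot all_order all_algebra.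
From mathcomp.multinomials Require Import mpoly.
Require Import Defs.

Set Implicit Arguments.
Unset Strict Implicit.
Unset Printing Implicit Defensive.

Import GRing.Theory.
Local Open Scope ring_scope.

(** The polynomial P(T) already determines T after y is specialized to a prime
    number l that is at least the number of vertices of T. Write p_T in Z[x]
    for the result, so that p_T = x for the one-vertex tree and
    p_T = l + prod p_(T_i) for the wedge of the T_i.

    p_T is monic, and modulo l it is a power of x, because the summand l
    disappears. If T has more than one vertex, then p_T(0) is congruent to l c
    modulo l^2 for an integer c with 0 < c < #|T|: when the root has two
    children or more, the product contributes a multiple of l^2 and c = 1; when
    it has one child, c grows by one. As #|T| <= l, the integer l^2 does not
    divide p_T(0), so p_T is irreducible by Eisenstein's criterion
    ([spec_poly_irreducible]).

    Factorizations into monic irreducible polynomials are unique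
    ([monic_irreducible_factors]). Subtracting l from p_T therefore recovers the
    multiset of the p_(T_i), and induction recovers T up to isomorphism
    ([spec_poly_inj]).

    For an unrooted tree, the same uniqueness reads off from the product the
    multiset of the p_R for the leaf contractions R. One leaf contraction
    determines the tree, by attaching a leaf to its root
    ([unrooted_iso_of_contraction]); the only tree without leaves has one
    vertex. Finally, the polynomial of a rooted tree has one irreducible factor,
    whereas that of an unrooted tree has as many as there are leaves, which is
    never one ([leaf_vertex_cases]). *)

(** * Unique factorization into monic irreducible polynomials *)

Definition monic_irreducible (R : idomainType) (p : {poly R}) : Prop :=
  p \is monic /\ irreducible_poly p.

Lemma irreducible_dvdp_prod (R : idomainType) (p : {poly R}) s :
  irreducible_poly p -> (p %| \prod_(q <- s) q)%R ->
  exists2 q, q \in s & (p %| q)%R.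
Proof.
move=> irrp; elim: s => [|q s IHs].
  by rewrite big_nil dvdp1 => /eqP sp; have := irrp.1; rewrite sp.
rewrite big_cons; have [pq _|npq] := boolP (p %| q)%R.
  by exists q => //; exact: mem_head.
rewrite Gauss_dvdpr ?irreducible_poly_coprime // => /IHs[r rs pr].
by exists r => //; rewrite inE rs orbT.
Qed.

Lemma monic_irreducible_dvdp_eq (R : idomainType) (p q : {poly R}) :
  monic_irreducible p -> monic_irreducible q -> (p %| q)%R -> p = q.
Proof.
move=> [mp ip] [mq iq] pq; apply/eqP; rewrite -eqp_monic //.
by apply: iq => //; rewrite neq_ltn ip.1 orbT.
Qed.

(** Each factor on the left divides the product on the right, hence one of its
    factors, to which it is equal because both are monic; cancel and repeat. *)
Lemma monic_irreducible_prod_inj (R : idomainType) (s t : seq {poly R}) :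
  {in s, forall p, monic_irreducible p} ->
  {in t, forall p, monic_irreducible p} ->
  \prod_(p <- s) p = \prod_(p <- t) p -> perm_eq s t.
Proof.
elim: s t => [|p s IHs] t irs irt.
  case: t irt => [|q t] irt; first by [].
  rewrite big_nil big_cons => e; have [_ iq] := irt q (mem_head _ _).
  have : (q %| 1)%R by rewrite e dvdp_mulr.
  by rewrite dvdp1 => /eqP sq; have := iq.1; rewrite sq.
have irp := irs p (mem_head _ _).
rewrite big_cons => e.
have [|q qt pq] := @irreducible_dvdp_prod _ p t irp.2.
  by rewrite -e dvdp_mulr.
have epq := monic_irreducible_dvdp_eq irp (irt _ qt) pq.
rewrite -epq {q pq epq} in qt.
have pt := perm_to_rem qt; rewrite perm_sym (perm_trans pt) // perm_cons.
rewrite perm_sym; apply: IHs => [q qs|q qr|].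
- by apply: irs; rewrite inE qs orbT.
- by apply: irt; rewrite (mem_rem qr).
apply: (mulfI (irredp_neq0 irp.2)).
by rewrite e (perm_big _ pt) big_cons.
Qed.

Lemma surj_inj_bij (A B : finType) (f : A -> B) :
  injective f -> (forall b, exists a, f a = b) -> bijective f.
Proof.
move=> fi /(@fin_all_exists B (fun=> A))[g gK].
by exists g => // a; apply: fi.
Qed.

(** A permutation carrying one listing of values to the other acts on the
    positions in these listings, hence on the indices. *)
Lemma perm_codom_bij (I J : finType) (S : eqType) (f : I -> S) (g : J -> S) :
  perm_eq (codom f) (codom g) ->
  exists h : I -> J, bijective h /\ forall i, f i = g (h i).
Proof.
move=> pfg; have /eqP cIJ := perm_size pfg; rewrite !size_codom in cIJ.
have [i0|noI] := pickP (@predT I); last first.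
  have [|h _] := @fin_all_exists I (fun=> J) (fun _ _ => True).
    by move=> i; have := noI i.
  exists h; split=> [|i]; last by have := noI i.
  by apply: inj_card_bij => [i|]; [have := noI i | rewrite (eqP cIJ)].
move=> _; have /(perm_iotaP (f i0))[Is pIs fE] := pfg.
have uIs : uniq Is by rewrite (perm_uniq pIs) iota_uniq.
have sIs : size Is = #|I|.
  by rewrite (perm_size pIs) size_iota size_codom (eqP cIJ).
have lIs i : (nth 0%N Is (@enum_rank I i) < #|J|)%N.
  have := perm_mem pIs (nth 0%N Is (enum_rank i)).
  by rewrite mem_iota size_codom mem_nth ?sIs ?ltn_ord // => /esym.
pose h i := enum_val (Ordinal (lIs i)).
exists h; split=> [|i].
  apply: inj_card_bij; last by rewrite (eqP cIJ).
  move=> i j /enum_val_inj/(congr1 val)/= /eqP.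
  rewrite nth_uniq ?sIs ?ltn_ord // => /eqP/val_inj; exact: enum_rank_inj.
have -> : f i = nth (f i0) (codom f) (enum_rank i).
  by rewrite nth_codom enum_rankK.
rewrite fE (nth_map 0%N) ?sIs ?ltn_ord //.
by rewrite (nth_codom _ _ (Ordinal (lIs i))).
Qed.

Lemma monic_irreducible_factors (R : idomainType) (I J : finType)
    (p : I -> {poly R}) (q : J -> {poly R}) :
  (forall i, monic_irreducible (p i)) -> (forall j, monic_irreducible (q j)) ->
  \prod_i p i = \prod_j q j ->
  exists h : I -> J, bijective h /\ forall i, p i = q (h i).
Proof.
move=> irp irq e; apply: perm_codom_bij.
apply: monic_irreducible_prod_inj.
- by move=> _ /codomP[i ->].
- by move=> _ /codomP[j ->].
by rewrite !big_image.
Qed.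

Lemma monic_constD (R : idomainType) (c : R) (p : {poly R}) :
  p \is monic -> (1 < size p)%N ->
  c%:P + p \is monic /\ (1 < size (c%:P + p)%R)%N.
Proof.
move=> mp sp; have cp : (size c%:P < size p)%N.
  by apply: leq_ltn_trans sp; exact: size_polyC_leq1.
by rewrite addrC monicE lead_coefDl // -monicE size_polyDl.
Qed.

Lemma size_monic_prod (R : idomainType) k (p : 'I_k.+1 -> {poly R}) :
  (forall i, p i \is monic) -> (forall i, 1 < size (p i))%N ->
  (1 < size (\prod_i p i)%R)%N.
Proof.
move=> mp sp; rewrite big_ord_recl size_monicM //; last first.
  by rewrite monic_neq0 // monic_prod.
have : (0 < size (\prod_(i < k) p (lift ord0 i))%R)%N.
  by rewrite size_poly_gt0 monic_neq0 // monic_prod.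
have := sp ord0; case: (size (p ord0)) => [|[|n]] // _.
by case: (size _) => // m _; rewrite addSn addnS.
Qed.

(** * Rooted trees as wedges *)

Lemma rooted_iso_sym (T1 T2 : rooted_tree) :
  rooted_iso T1 T2 -> rooted_iso T2 T1.
Proof.
move=> [f [[g fK gK] ef rf]]; exists g; split; first by exists f.
  by move=> u v; rewrite -ef !gK.
by rewrite -rf fK.
Qed.

Lemma rooted_iso_trans (T1 T2 T3 : rooted_tree) :
  rooted_iso T1 T2 -> rooted_iso T2 T3 -> rooted_iso T1 T3.
Proof.
move=> [f [bf ef rf]] [g [bg eg rg]]; exists (g \o f).
split; first exact: bij_comp.
  by move=> u v; rewrite /= eg ef.
by rewrite /= rf rg.
Qed.

Lemma rooted_iso_card (T1 T2 : rooted_tree) :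
  rooted_iso T1 T2 -> #|T1| = #|T2|.
Proof. by move=> [f [/bij_eq_card]]. Qed.

Lemma bullet_iso (T1 T2 : rooted_tree) :
  #|T1| = 1%N -> #|T2| = 1%N -> rooted_iso T1 T2.
Proof.
move=> c1 c2; exists (fun=> rroot T2); split=> //.
  apply: inj_card_bij; last by rewrite c1 c2.
  by move=> u v _; apply: fintype_le1P; rewrite c1.
have [r rE] := fintype1 c1.
by move=> u v; rewrite (rE u) (rE v) !(tree_irr (rvertP _)).
Qed.

(** The wedge depends only on the multiset of isomorphism classes of its
    components, so the bijection [h] may permute them. *)
Lemma wedge_iso k k' (Ts : 'I_k -> rooted_tree) (Ts' : 'I_k' -> rooted_tree)
    (h : 'I_k -> 'I_k') :
  bijective h -> (forall i, rooted_iso (Ts i) (Ts' (h i))) ->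
  rooted_iso (wedge Ts) (wedge Ts').
Proof.
move=> bh /(@fin_all_exists _ (fun i => Ts i -> Ts' (h i)))[f fP].
have hi := bij_inj bh.
pose F (u : wedge Ts) : wedge Ts' :=
  if u is Some b then wedge_in (f (tag b) (tagged b)) else wedge_root Ts'.
have Fin i (a : Ts i) : F (wedge_in a) = wedge_in (f i a) by [].
have Fi : injective F.
  move=> [[i a]|] [[j b]|] // e.
  have ij : i = j by case: e => /hi.
  have [/bij_inj fi _ _] := fP i.
  by case: j / ij b e => b /wedge_in_inj/fi /= ->.
exists F; split=> //.
  apply: surj_inj_bij => // -[[j b]|]; last by exists None.
  have [g _ gK] := bh; move: b; rewrite -(gK j) => b.
  have [[f' _ fK'] _ _] := fP (g j).
  by exists (wedge_in (f' b)); rewrite Fin fK'.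
move=> [[i a]|] [[j b]|] //.
- have [ij|nij] := eqVneq i j.
    case: j / ij b => b; apply: etrans (wedge_edge_in (f i a) (f i b)) _.
    have [_ -> _] := fP i; exact/esym/wedge_edge_in.
  by rewrite /= (inj_eq hi) !(negPf nij).
- by have [/bij_inj fi _ fr] := fP i; rewrite /= -fr (inj_eq fi).
- by have [/bij_inj fi _ fr] := fP j; rewrite /= -fr (inj_eq fi).
Qed.

Section Decomposition.
Variable T : rooted_tree.
Implicit Types c u v : T.

Lemma redge_off_root_sym : ssrbool.symmetric (@redge_off_root T).
Proof.
move=> u v; rewrite /redge_off_root /= (tree_sym (rvertP T)).
by rewrite (andbC (u != _)).
Qed.

(** A path from [c] to another child [c'] off the root would close up into a
    cycle through the root. *)
Lemma branch_children_eq c c' : redge (rroot T) c -> redge (rroot T) c' ->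
  in_branch c c' -> c = c'.
Proof.
move=> rc rc' /connectP[p pp].
case/shortenP: pp => {}p pp up _ lp.
have sp : path redge c p by apply: sub_path pp => x y /and3P[].
have rp : rroot T \notin c :: p.
  apply/negP => /(path_connect pp) rb.
  by have := root_notin_branch (redge_root_neq rc); rewrite /in_branch rb.
have : ucycle redge (rroot T :: c :: p).
  rewrite /ucycle /= rc rcons_path sp -lp (tree_sym (rvertP T)) rc' /=.
  by rewrite rp; move: up => /=.
by move/(tree_acyclic (rvertP T)); case: (p) lp.
Qed.

Lemma branch_disjoint c c' u : redge (rroot T) c -> redge (rroot T) c' ->
  in_branch c u -> in_branch c' u -> c = c'.
Proof.
move=> rc rc' cu c'u; apply: branch_children_eq rc rc' _.
apply: connect_trans cu _.
by rewrite (sym_connect_sym redge_off_root_sym).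
Qed.

(** Follow a simple path from the root to [u]: its first step is to a child, and
    it never returns to the root. *)
Lemma branch_cover u : u != rroot T ->
  exists2 c, redge (rroot T) c & in_branch c u.
Proof.
move=> ur; have /connectP[p] := tree_connected (rvertP T) (rroot T) u.
case/shortenP => {}p pp up _ lp; case: p pp up lp => [|c p].
  by move=> _ _ e; rewrite e eqxx in ur.
rewrite cons_uniq => /= /andP[rc pp] /andP[rp _] lp; exists c => //.
apply/connectP; exists p => //.
elim: p c {rc lp u ur} pp rp => //= d p IHp c /andP[cd pd].
rewrite inE negb_or => /andP[rc rd].
rewrite /redge_off_root /= cd eq_sym rc IHp // andbT.
by move: rd; rewrite inE negb_or eq_sym => /andP[].
Qed.

Definition child : finType := {c : T | redge (rroot T) c}.

Definition child_branch (i : 'I_#|child|) : rooted_tree :=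
  branch (val (enum_val i)).

(** Every vertex other than the root lies in exactly one branch, edges do not
    cross branches, and each branch meets the root only through its own root. *)
Lemma wedge_child_branch : rooted_iso (wedge child_branch) T.
Proof.
pose F (u : wedge child_branch) : T :=
  if u is Some b then val (tagged b) else rroot T.
have Fr i (a : child_branch i) : val a != rroot T.
  have := root_notin_branch (redge_root_neq (valP (enum_val i))).
  by apply: contraNneq => ar; have := valP a; rewrite ar.
have child_eq (i j : 'I_#|child|) u : in_branch (val (enum_val i : child)) u ->
    in_branch (val (enum_val j : child)) u -> i = j.
  move=> iu ju; apply/enum_val_inj/val_inj.
  exact: (branch_disjoint (valP _) (valP _) iu ju).
have edge_r i (a : child_branch i) :
    redge (rroot T) (val a) = (a == rroot (child_branch i)).
  apply/idP/eqP => [ra|->]; last exact: (valP (enum_val i)).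
  apply: val_inj; rewrite [RHS]/=; apply/esym.
  exact: (branch_children_eq (valP (enum_val i)) ra (valP a)).
exists F; split=> //.
  apply: surj_inj_bij => [[[i a]|] [[j b]|]|u].
  - move=> e; have ij : i = j.
      apply: (child_eq i j (val a)); first exact: (valP a).
      rewrite (e : val a = val b); exact: (valP b).
    by case: j / ij b e => b /val_inj /= ->.
  - by move=> e; have /eqP[] := Fr _ a.
  - by move=> e; have /eqP[] := Fr _ b; exact: esym.
  - by [].
  have [->|ur] := eqVneq u (rroot T); first by exists None.
  have [c rc cu] := branch_cover ur.
  have cE : c = val (enum_val (enum_rank (Sub c rc : child))).
    by rewrite enum_rankK.
  rewrite cE in cu.
  by exists (wedge_in (Sub u cu : child_branch (enum_rank (Sub c rc : child)))).
move=> [[i a]|] [[j b]|].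
- have [ij|nij] := eqVneq i j.
    by case: j / ij b => b; rewrite /= eqxx tagged_asE.
  rewrite /= (negPf nij); apply/negP => ab; move/eqP: nij; apply.
  apply: (child_eq i j (val b)); last exact: (valP b).
  apply: connect_trans (valP a) (connect1 _).
  by rewrite /redge_off_root /= ab !Fr.
- by rewrite /= (tree_sym (rvertP T)) edge_r.
- by rewrite /= edge_r.
- by rewrite /= (tree_irr (rvertP T)).
Qed.

End Decomposition.

Lemma wedge_cases (T : rooted_tree) :
  #|T| = 1%N \/
  exists k (Ts : 'I_k.+1 -> rooted_tree), rooted_iso (wedge Ts) T.
Proof.
have := wedge_child_branch T; move: (@child_branch T).
case: #|child T| => [|k] Ts iT; last by right; exists k, Ts.
left; rewrite -(rooted_iso_card iT) card_option.
by congr _.+1; apply: eq_card0 => -[[]].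
Qed.

Lemma card_wedge_branch k (Ts : 'I_k -> rooted_tree) (i : 'I_k) :
  (#|Ts i| < #|wedge Ts|)%N.
Proof.
by rewrite (rooted_iso_card (wedge_branch_iso Ts i)); apply: card_branch => /=.
Qed.

(** This turns the recursive definition of the tree polynomial into an induction
    for rooted trees given as graphs, up to isomorphism. *)
Lemma wedge_ind (P : rooted_tree -> Prop) :
  (forall T1 T2, rooted_iso T1 T2 -> P T1 -> P T2) ->
  (forall T : rooted_tree, #|T| = 1%N -> P T) ->
  (forall k (Ts : 'I_k.+1 -> rooted_tree),
     (forall i, P (Ts i)) -> P (wedge Ts)) ->
  forall T, P T.
Proof.
move=> Piso P1 Pw T; have [n] := ubnP #|T|; elim: n T => // n IHn T Tn.
have [/P1 //|[k [Ts iT]]] := wedge_cases T.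
apply: (Piso _ _ iT); apply: Pw => i; apply: IHn.
rewrite -ltnS (leq_trans _ Tn) // ltnS -(rooted_iso_card iT).
exact: card_wedge_branch.
Qed.

(** * Specializing y to a prime number *)

Section Specialization.
Variable l : nat.

(** The substitution y := l, as a ring morphism to Z[x]. *)
Definition spec : Zxy -> {poly int} :=
  mmap (@polyC int) (fun i : 'I_2 => if i == ord0 then 'X else l%:Z%:P).

Lemma spec_x : spec var_x = 'X.
Proof. by rewrite /spec mmapX mmap1U eqxx. Qed.

Lemma spec_y : spec var_y = l%:Z%:P.
Proof. by rewrite /spec mmapX mmap1U. Qed.

Definition spec_poly (T : rooted_tree) : {poly int} := spec (rooted_poly T).

Lemma spec_poly_bullet (T : rooted_tree) : #|T| = 1%N -> spec_poly T = 'X.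
Proof. by move=> T1; rewrite /spec_poly rooted_poly_bullet ?spec_x. Qed.

Lemma spec_poly_iso (T1 T2 : rooted_tree) :
  rooted_iso T1 T2 -> spec_poly T1 = spec_poly T2.
Proof. by rewrite /spec_poly => /rooted_poly_iso ->. Qed.

Lemma spec_poly_wedge k (Ts : 'I_k.+1 -> rooted_tree) :
  spec_poly (wedge Ts) = l%:Z%:P + \prod_i spec_poly (Ts i).
Proof.
rewrite /spec_poly rooted_poly_wedge // /spec rmorphD rmorph_prod.
by congr (_ + _); exact: spec_y.
Qed.

End Specialization.

Section Eisenstein.
Variable l : nat.
Hypothesis prime_l : prime l.

Lemma spec_poly_monic (T : rooted_tree) :
  spec_poly l T \is monic /\ (1 < size (spec_poly l T))%N.
Proof.
elim/wedge_ind: T => [T1 T2 /(spec_poly_iso l) -> //|T T1|k Ts IH].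
  by rewrite spec_poly_bullet // monicX size_polyX.
rewrite spec_poly_wedge; apply: monic_constD.
  by apply: monic_prod => i _; case: (IH i).
by apply: size_monic_prod => i; case: (IH i).
Qed.

(** Reduction modulo l kills the constant l added at each wedge. *)
Lemma spec_poly_mod (T : rooted_tree) :
  exists n, map_poly (intr : int -> 'F_l) (spec_poly l T) = 'X^n.
Proof.
elim/wedge_ind: T => [T1 T2 /(spec_poly_iso l) -> //|T T1|k Ts].
  by exists 1%N; rewrite spec_poly_bullet // map_polyX.
move=> /(@fin_all_exists _ (fun=> nat))[n nE]; exists (\sum_i n i)%N.
rewrite spec_poly_wedge rmorphD rmorph_prod /= map_polyC /=.
rewrite (eq_bigr _ (fun i _ => nE i)) -expr_sum.
by rewrite -pmulrn pchar_Fp_0 // polyC0 add0r.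
Qed.

(** Since the polynomial is monic, the exponent in [spec_poly_mod] is its
    degree, and all its other coefficients vanish modulo l. *)
Lemma spec_poly_coef_dvd (T : rooted_tree) i :
  (i < (size (spec_poly l T)).-1)%N -> (l %| (spec_poly l T)`_i)%Z.
Proof.
have [mp sp] := spec_poly_monic T; have [n nE] := spec_poly_mod T => iT.
have := congr1 (fun q : {poly 'F_l} => size q) nE.
rewrite size_polyXn size_map_poly_id0 ?(monicP mp) ?rmorph1 ?oner_eq0 // => sT.
rewrite sT in iT; have := congr1 (fun q : {poly 'F_l} => q`_i) nE.
rewrite coef_map coefXn (ltn_eqF iT) => /eqP.
by rewrite /= -(dvdz_pcharf (pchar_Fp prime_l)).
Qed.

(** If n vertices with a single child lead from the root down to a vertex that
    has no child or several, then c is n in the first case and n + 1 in the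
    second. *)
Lemma spec_poly_const_mod (T : rooted_tree) :
  exists2 c : nat, ((#|T| != 1) <= c < #|T|)%N &
    (l ^+ 2 %| (spec_poly l T)`_0 - l%:Z * c%:Z)%Z.
Proof.
elim/wedge_ind: T => [T1 T2 iT|T T1|k Ts IH].
- by rewrite (spec_poly_iso l iT) (rooted_iso_card iT).
- by exists 0%N; rewrite ?T1 // spec_poly_bullet // coefX mulr0 subr0 dvdz0.
have w1 i := card_wedge_branch Ts i.
have c0 i : exists d : int, (spec_poly l (Ts i))`_0 = d * l%:Z.
  have [c _ /dvdzP[d /eqP]] := IH i; rewrite subr_eq => /eqP ->.
  by exists (d * l%:Z + c%:Z); rewrite mulrDl -mulrA -expr2 (mulrC c%:Z).
rewrite spec_poly_wedge -horner_coef0 hornerD hornerC horner_prod.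
case: k Ts IH w1 c0 => [|k] Ts IH w1 c0.
  have [c /andP[_ cT] dc] := IH ord0; exists c.+1.
    by rewrite (leq_trans (leq_b1 _)) //= (leq_ltn_trans cT).
  rewrite big_ord1 horner_coef0 intS mulrDr mulr1.
  by rewrite (addrC l%:Z) addrKA.
(* Two components already make the product divisible by l^2. *)
exists 1%N.
  by rewrite leq_b1 (leq_ltn_trans (tree_nonempty (rvertP (Ts ord0)))).
rewrite mulr1 addrAC subrr add0r big_ord_recl big_ord_recl !horner_coef0.
have [[d ->] [d' ->]] := (c0 ord0, c0 (lift ord0 ord0)).
by rewrite mulrA (mulrACA d) -expr2 dvdz_mulr // dvdz_mull // dvdzz.
Qed.

Lemma spec_poly_const_ndvd (T : rooted_tree) :
  (1 < #|T| <= l)%N -> ~~ (l ^+ 2 %| (spec_poly l T)`_0)%Z.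
Proof.
move=> /andP[T1 Tl]; have [c /andP[c0 cT] dc] := spec_poly_const_mod T.
apply/negP => d0; have {dc} : (l%:Z * l%:Z %| l%:Z * c%:Z)%Z.
  by move: dc; rewrite rpredBl.
have l0 : l%:Z != 0 by rewrite eqz_nat -lt0n prime_gt0.
rewrite dvdz_mul2l // dvdzE /= gtnNdvd ?(leq_trans cT) //.
by apply: leq_trans c0; rewrite neq_ltn T1 orbT.
Qed.

Lemma spec_poly_irreducible (T : rooted_tree) :
  (#|T| <= l)%N -> monic_irreducible (spec_poly l T).
Proof.
move=> Tl; have [mT sT] := spec_poly_monic T; split=> //.
(* Eisenstein's criterion does not apply to x itself, whose constant
   coefficient is 0. *)
have [T1|T1] := eqVneq #|T| 1%N.
  by rewrite spec_poly_bullet // -['X]subr0 -polyC0; exact: irredp_XsubC.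
apply: (eisenstein_crit prime_l); first by rewrite neq_ltn sT orbT.
- by rewrite (monicP mT) dvdz1 absz_nat neq_ltn prime_gt1 ?orbT.
- apply: spec_poly_const_ndvd; rewrite Tl andbT ltn_neqAle eq_sym T1.
  exact: tree_nonempty (rvertP T).
- exact: spec_poly_coef_dvd.
Qed.

End Eisenstein.

(** Once the constant l is removed, unique factorization matches the branches of
    the two trees. The one-vertex tree is told apart by its constant
    coefficient 0, which is divisible by l^2. *)
Lemma spec_poly_inj l (T1 T2 : rooted_tree) : prime l ->
  (#|T1| <= l)%N -> (#|T2| <= l)%N -> spec_poly l T1 = spec_poly l T2 ->
  rooted_iso T1 T2.
Proof.
move=> pl T1l T2l.
have bullet (T T' : rooted_tree) : (#|T'| <= l)%N -> #|T| = 1%N ->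
    spec_poly l T = spec_poly l T' -> #|T'| = 1%N.
  move=> T'l c1 e; apply/eqP; apply: contraT => T'1.
  have := @spec_poly_const_ndvd _ pl T'; rewrite -e spec_poly_bullet // coefX.
  rewrite dvdz0 T'l andbT; apply.
  by rewrite ltn_neqAle eq_sym T'1 (tree_nonempty (rvertP T')).
elim/wedge_ind: T1 T2 T1l T2l => [T1 T1' iT IH|T1 c1|k Ts IH] T2 T1l T2l.
- rewrite -(spec_poly_iso l iT) => e.
  apply: rooted_iso_trans (rooted_iso_sym iT) _.
  by apply: IH => //; rewrite (rooted_iso_card iT).
- by move=> /(bullet _ _ T2l c1); exact: bullet_iso.
move=> e; have [c2|[k' [Ts' iT]]] := wedge_cases T2.
  by apply: bullet_iso => //; apply: bullet c2 (esym e).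
apply: (rooted_iso_trans _ iT); rewrite -(spec_poly_iso l iT) in e.
rewrite -(rooted_iso_card iT) in T2l.
have leW n (S : 'I_n.+1 -> rooted_tree) (i : 'I_n.+1) :
    (#|wedge S| <= l)%N -> (#|S i| <= l)%N.
  by apply: leq_trans; exact/ltnW/card_wedge_branch.
move: e; rewrite !spec_poly_wedge => /addrI.
case/monic_irreducible_factors => [i|i|h [bh hE]].
- by apply: spec_poly_irreducible => //; exact: leW.
- by apply: spec_poly_irreducible => //; exact: leW.
by apply: (wedge_iso bh) => i; apply: IH (hE i); exact: leW.
Qed.

(** * Leaves of unrooted trees *)

Section Leaves.
Variable T : unrooted_tree.
Implicit Types u v w r : T.

Lemma uedge_neq u v : uedge u v -> u != v.
Proof. by apply: contraTneq => ->; rewrite (tree_irr (uvertP T)). Qed.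

(** Extend the path backwards from [u] as long as possible. A neighbour of [u]
    other than [v] cannot lie on the path, which would close a cycle, so the
    process stops only at a leaf, and this leaf differs from the far end
    [last v q] because the path stays simple. *)
Lemma leaf_above u v (q : seq T) :
  path uedge u (v :: q) -> uniq (u :: v :: q) ->
  exists w, degree w == 1%N /\ w != last v q.
Proof.
have [n] := ubnP (#|T| - size q); elim: n => // n IHn in u v q *.
move=> qn pq uq; have [d1|d1] := boolP (degree u == 1%N).
  exists u; split=> //; apply: contraTneq uq => ->.
  by rewrite cons_uniq mem_last.
have [w uw wv] : exists2 w, uedge u w & w != v.
  have uv : uedge u v by case/andP: pq.
  have [w] : exists w, w \in [set w | uedge u w] :\ v.
    apply/set0Pn; apply: contra d1; rewrite setD_eq0 => sv.
    apply/cards1P; exists v; apply/eqP; rewrite eqEsubset sv sub1set inE //.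
  by rewrite !inE => /andP[wv uw]; exists w.
have wu : uedge w u by rewrite (tree_sym (uvertP T)).
have [wq|nwq] := boolP (w \in u :: v :: q); last first.
  apply: (IHn w u (v :: q)); last by rewrite cons_uniq nwq.
    have sT : (size (u :: v :: q) <= #|T|)%N.
      by rewrite -(card_uniqP uq) max_card.
    rewrite ltnS in qn; apply: leq_trans qn; rewrite ltn_sub2l //.
    exact: ltnW sT.
  by rewrite /= wu.
move: wq; rewrite !inE (negPf wv) eq_sym (negPf (uedge_neq uw)) /= => wq.
case/splitPr: wq pq uq {IHn qn} => q1 q2.
rewrite -cat_rcons -!cat_cons cat_uniq cat_path => /andP[pq _] /andP[uq _].
have /(tree_acyclic (uvertP T)) : ucycle uedge (u :: v :: rcons q1 w).
  by rewrite /ucycle uq andbT /cycle rcons_path pq /= last_rcons.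
by rewrite /= size_rcons.
Qed.

Lemma leaf_neq r : (1 < #|T|)%N -> exists v, degree v == 1%N /\ v != r.
Proof.
move=> T1; have [u ur] : exists u, u != r.
  have /card_gt0P[u] : (0 < #|predC1 r|)%N by rewrite cardC1 -subn1 subn_gt0.
  by exists u.
have /connectP[p] := tree_connected (uvertP T) u r.
case/shortenP => {}p pp up _; case: p pp up => [|v q] pp up lp.
  by rewrite lp eqxx in ur.
have [w wP] := leaf_above pp up.
by exists w; rewrite lp.
Qed.

Lemma card_leaf_vertex_gt1 : (1 < #|T|)%N -> (1 < #|leaf_vertex T|)%N.
Proof.
move=> T1; have /card_gt0P[r _] := ltnW T1.
have [v [dv _]] := leaf_neq r T1; have [w [dw wv]] := leaf_neq v T1.
apply/card_gt1P; exists (Sub v dv), (Sub w dw); split=> //.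
by rewrite eq_sym -val_eqE.
Qed.

Lemma card_leaf_vertex0 : #|T| = 1%N -> #|leaf_vertex T| = 0%N.
Proof.
move=> T1; apply: eq_card0 => v; have [x xE] := fintype1 T1.
have [[u uv] _] := leaf_neighbour v.
by rewrite (xE u) (xE (val v)) eqxx in uv.
Qed.

Lemma card_leaf_contraction (v : leaf_vertex T) :
  (#|leaf_contraction v| <= #|T|)%N.
Proof. by rewrite card_sig max_card. Qed.

Lemma leaf_root_edge (v : leaf_vertex T) (u : leaf_contraction v) :
  uedge (val v) (val u) = (u == rroot (leaf_contraction v)).
Proof.
have vr := xchooseP (leaf_neighbour v).
apply/idP/eqP => [vu|-> //]; apply: val_inj.
have /cards1P[t tE] := valP v.
have /set1P -> : val u \in [set t] by rewrite -tE inE.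
by apply/esym/set1P; rewrite -tE inE.
Qed.

End Leaves.

(** A leaf is attached to the rest of the tree only through the root of its
    contraction, so an isomorphism of the contractions extends by sending leaf
    to leaf. *)
Lemma unrooted_iso_of_contraction (T1 T2 : unrooted_tree)
    (v1 : leaf_vertex T1) (v2 : leaf_vertex T2) :
  rooted_iso (leaf_contraction v1) (leaf_contraction v2) -> unrooted_iso T1 T2.
Proof.
move=> [f [[g fK gK] ef rf]].
pose F (T T' : unrooted_tree) (v : leaf_vertex T) (v' : leaf_vertex T')
    (h : leaf_contraction v -> leaf_contraction v') (u : T) : T' :=
  if insub u is Some w then val (h w) else val v'.
have Fv T T' v v' h : @F T T' v v' h (val v) = val v'.
  by rewrite /F insubF // eqxx.
have Fw T T' v v' h w : @F T T' v v' h (val w) = val (h w).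
  by rewrite /F valK.
have case_v (T : unrooted_tree) (v : leaf_vertex T) u :
    u = val v \/ exists w : leaf_contraction v, u = val w.
  have [->|uv] := eqVneq u (val v); first by left.
  by right; exists (Sub u uv); rewrite SubK.
exists (F _ _ _ _ f); split.
  exists (F _ _ _ _ g) => u.
    by have [->|[w ->]] := case_v _ v1 u; rewrite ?Fv // !Fw fK.
  by have [->|[w ->]] := case_v _ v2 u; rewrite ?Fv // !Fw gK.
have er (w : leaf_contraction v1) :
    uedge (val v2) (val (f w)) = uedge (val v1) (val w).
  by rewrite !leaf_root_edge -rf (inj_eq (can_inj fK)).
move=> u w; have [->|[{}u ->]] := case_v _ v1 u;
  have [->|[{}w ->]] := case_v _ v1 w.
- by rewrite !Fv !(tree_irr (uvertP _)).
- by rewrite Fv Fw er.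
- by rewrite Fv Fw (tree_sym (uvertP T2)) (tree_sym (uvertP T1)) er.
- by rewrite !Fw; exact: ef.
Qed.

Lemma unrooted_poly_iso (T1 T2 : unrooted_tree) :
  unrooted_iso T1 T2 -> unrooted_poly T1 = unrooted_poly T2.
Proof.
move=> [f [[g fK gK] ef]].
have df v : degree (f v) = degree v.
  rewrite /degree -(card_imset _ (can_inj fK)); apply: eq_card => u.
  rewrite inE; apply/idP/imsetP => [e|[w]].
    by exists (g u); rewrite ?gK // inE -ef gK.
  by rewrite inE => e ->; rewrite ef.
have fl (v : leaf_vertex T1) : degree (f (val v)) == 1%N.
  by rewrite df; exact: (valP v).
have gl (v : leaf_vertex T2) : degree (g (val v)) == 1%N.
  by rewrite -df gK; exact: (valP v).
pose F v : leaf_vertex T2 := Sub (f (val v)) (fl v).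
have bF : bijective F.
  exists (fun v => Sub (g (val v)) (gl v)) => v; apply: val_inj => /=.
    by rewrite fK.
  by rewrite gK.
rewrite /unrooted_poly (reindex F) /=; last exact: onW_bij.
apply: eq_bigr => v _; apply: rooted_poly_iso.
have fn (u : leaf_contraction v) : f (val u) != val (F v).
  by rewrite /= (inj_eq (can_inj fK)); exact: (valP u).
have gn (u : leaf_contraction (F v)) : g (val u) != val v.
  by apply: contraNneq (valP u) => gv; apply/eqP; rewrite -[LHS]gK gv.
exists (fun u => Sub (f (val u)) (fn u) : leaf_contraction (F v)); split.
- exists (fun u => Sub (g (val u)) (gn u) : leaf_contraction v) => u;
    apply: val_inj => /=.
    by rewrite fK.
  by rewrite gK.
- by move=> u w; exact: ef.
apply/eqP; rewrite -leaf_root_edge /= ef.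
exact: (xchooseP (leaf_neighbour v)).
Qed.

Lemma unrooted_trivial_iso (T1 T2 : unrooted_tree) :
  #|T1| = 1%N -> #|T2| = 1%N -> unrooted_iso T1 T2.
Proof.
move=> c1 c2; have [x xE] := fintype1 c1; have [y yE] := fintype1 c2.
exists (fun=> y); split.
  by exists (fun=> x) => u; rewrite ?(xE u) ?(yE u).
by move=> u v; rewrite (xE u) (xE v) !(tree_irr (uvertP _)).
Qed.

(** In particular the number of leaves is never one, which separates unrooted
    from rooted trees, and it is zero only for the one-vertex tree. *)
Lemma leaf_vertex_cases (T : unrooted_tree) :
  #|T| = 1%N /\ #|leaf_vertex T| = 0%N \/ (1 < #|leaf_vertex T|)%N.
Proof.
have := tree_nonempty (uvertP T); rewrite leq_eqVlt => /orP[/eqP T1|T1].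
  by left; rewrite card_leaf_vertex0.
by right; exact: card_leaf_vertex_gt1.
Qed.

(** * Trees are determined by their polynomial *)

Lemma spec_unrooted_poly l (T : unrooted_tree) :
  spec l (unrooted_poly T) =
    \prod_(v : leaf_vertex T) spec_poly l (leaf_contraction v).
Proof. exact: rmorph_prod. Qed.

Lemma unrooted_poly_inj (T1 T2 : unrooted_tree) :
  unrooted_poly T1 = unrooted_poly T2 -> unrooted_iso T1 T2.
Proof.
have [l ml pl] := prime_above (maxn #|T1| #|T2|).
move: ml; rewrite gtn_max => /andP[/ltnW T1l /ltnW T2l].
have b1 v := leq_trans (@card_leaf_contraction T1 v) T1l.
have b2 v := leq_trans (@card_leaf_contraction T2 v) T2l.
move=> /(congr1 (spec l)); rewrite !spec_unrooted_poly.
case/monic_irreducible_factors => [v|v|h [bh hE]].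
- exact: spec_poly_irreducible.
- exact: spec_poly_irreducible.
have c12 := bij_eq_card bh.
have [[T1_1 L1]|L1] := leaf_vertex_cases T1.
  have [[T2_1 _]|L2] := leaf_vertex_cases T2; first exact: unrooted_trivial_iso.
  by rewrite -c12 L1 in L2.
have /card_gt0P[v _] := ltnW L1.
by apply: (@unrooted_iso_of_contraction _ _ v (h v)); apply: (spec_poly_inj pl).
Qed.

Lemma rooted_unrooted_poly_neq (R : rooted_tree) (U : unrooted_tree) :
  rooted_poly R <> unrooted_poly U.
Proof.
have [l ml pl] := prime_above (maxn #|R| #|U|).
move: ml; rewrite gtn_max => /andP[/ltnW Rl /ltnW Ul].
move=> /(congr1 (spec l)); rewrite spec_unrooted_poly -/(spec_poly l R).
have -> : spec_poly l R = \prod_(i < 1) spec_poly l R by rewrite big_ord1.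
case/monic_irreducible_factors => [_|v|h [/bij_eq_card]].
- exact: spec_poly_irreducible.
- apply: spec_poly_irreducible => //.
  exact: leq_trans (card_leaf_contraction v) Ul.
by rewrite card_ord => e; have [[_ L]|L] := leaf_vertex_cases U;
  rewrite -e in L.
Qed.

Lemma rooted_poly_inj (T1 T2 : rooted_tree) :
  rooted_poly T1 = rooted_poly T2 -> rooted_iso T1 T2.
Proof.
have [l ml pl] := prime_above (maxn #|T1| #|T2|).
move: ml; rewrite gtn_max => /andP[/ltnW T1l /ltnW T2l] e.
by apply: (spec_poly_inj pl) => //; rewrite /spec_poly e.
Qed.

Theorem theorem3p2 (T1 T2 : tree) :
  tree_iso T1 T2 <-> tree_poly T1 = tree_poly T2.
Proof.
case: T1 T2 => [R1|U1] [R2|U2] /=.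
- by split; [exact: rooted_poly_iso | exact: rooted_poly_inj].
- by split=> // /rooted_unrooted_poly_neq.
- by split=> // /esym/rooted_unrooted_poly_neq.
- by split; [exact: unrooted_poly_iso | exact: unrooted_poly_inj].
Qed.
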